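(* Let $A$ be a finite set and let $q:A\times A\to\mathbb C$ be an integrable weight on $A$ with matrix $Q=[q(x,y)]_{x,y\in A}$. Let $m$ be the unrooted loop measure of $q$ on $A$. 1. If $x\in A$, then $\exp\{m[\mathcal L(A;x)]\}=G_A(x,x)$. 2. If $B\subset A$, then $F_B(A)=\exp\{m[\mathcal L(A;B)]\}$. 3. In particular, $\exp\{m[\mathcal L(A)]\}=F(A)=\det G_A=\dfrac1{\det[I-Q]}$.
   Context: $q$ is integrable if the matrix $[|q(x,y)|]_{x,y\in A}$ has spectral radius strictly less than $1$. A path in a set $V\subset A$ is a finite sequence $\omega=[\omega_0,\dots,\omega_n]$ of elements of $V$ ($n\ge0$), $|\omega|=n$, $q(\omega)=\prod_{j=1}^n q(\omega_{j-1},\omega_j)$ (equal to $1$ if $n=0$). $\mathcal K_V(x,y)$ is the set of paths in $V$ from $x$ to $y$ (including $[x]$ if $x=y$), and the Green's function is $G_V(x,y)=\sum_{\omega\in\mathcal K_V(x,y)}q(\omega)$; as a matrix $G_A=(I-Q)^{-1}$. For $B=\{x_1,\dots,x_n\}\subset A$, $F_B(A)=\prod_{j=1}^nG_{A_j}(x_j,x_j)$ with $A_j=A\setminus\{x_1,\dots,x_{j-1}\}$ (this does not depend on the ordering of $B$); $F(A)=F_A(A)$. A nontrivial rooted loop is a path $l=[l_0,\dots,l_n]$ with $n\ge1$ and $l_n=l_0$. An unrooted (oriented) loop $\ell$ is an equivalence class of nontrivial rooted loops under cyclic shift of the root $[l_0,l_1,\dots,l_n]\sim[l_1,\dots,l_n,l_1]\sim\cdots$;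 $q(\ell),|\ell|$ denote the common values over representatives, and $s_\ell$ is the number of distinct representatives. The unrooted loop measure is $m(\ell)=s_\ell\,q(\ell)/|\ell|$, and $m[V]=\sum_{\ell\in V}m(\ell)$. $\mathcal L(A)$ is the set of unrooted loops in $A$, $\mathcal L(A;B)$ is the set of those visiting at least one vertex of $B$, and $\mathcal L(A;x)=\mathcal L(A;\{x\})$. *)

(* Defs.v *)
From HB Require Import structures.
From mathcomp Require Import all_boot all_order all_algebra generic_quotient.
From mathcomp Require Import finmap.
From mathcomp Require Import all_classical all_reals all_analysis.
From mathcomp Require Import complex.

Set Implicit Arguments.
Unset Strict Implicit.
Unset Printing Implicit Defensive.

Import Order.TTheory GRing.Theory Num.Theory.

Local Open Scope ring_scope.
Local Open Scope complex_scope.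
Local Open Scope quotient_scope.

Section ComplexAnalysis.
Variable R : realType.

Definition cexp (z : R[i]) : R[i] :=
  let: a +i* b := z in (expR a * cos b) +i* (expR a * sin b).

(* Unordered sums over an arbitrary index set D, i.e. integrals with respect to
   the counting measure of D.  [csum D f] is the sum of the family when the
   family is absolutely summable and is meaningless otherwise. *)
Definition rsum (I : choiceType) (D : set I) (f : I -> R) : R :=
  fine (esum D (fun i => (Num.max (f i) 0)%:E)) -
  fine (esum D (fun i => (Num.max (- f i) 0)%:E)).

Definition csum (I : choiceType) (D : set I) (f : I -> R[i]) : R[i] :=
  rsum D (fun i => complex.Re (f i)) +i* rsum D (fun i => complex.Im (f i)).

(* For n = 0 there are no eigenvalues and the value is sup set0 = 0. *)
Definition spectral_radius (n : nat) (M : 'M[R[i]]_n) : R :=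
  sup [set complex.Re `|z| | z in [set z | eigenvalue M z]]%classic.

End ComplexAnalysis.

Section Loops.
Variable A : finType.

(* A rooted loop [l_0, ..., l_n] is stored with both end points, l_n = l_0. *)
Definition is_rooted_loop (l : seq A) : bool :=
  if l is x :: s then (s != [::]) && (last x s == x) else false.

Definition rooted_loop := {l : seq A | is_rooted_loop l}.

(* [l_0, l_1, ..., l_n] |-> [l_1, ..., l_n, l_1] *)
Definition shift_root (l : seq A) : seq A :=
  if l is _ :: (y :: _) as s then rcons s y else l.

Definition loop_equiv (l l' : rooted_loop) : bool :=
  `[< exists k, iter k shift_root (val l) = val l' >].

Lemma iter_shift_root k x s : s != [::] -> last x s = x ->
  iter k shift_root (x :: s) =
    last x (iter k (rot 1) s) :: iter k (rot 1) s.
Proof.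
move=> s0 lx; elim: k => [|k IH]; first by rewrite /= lx.
have : iter k (rot 1) s != [::].
  elim: k {IH} => [//|k IH]; apply: contraNneq IH => /= /(congr1 size).
  by rewrite size_rot => /size0nil ->.
rewrite !iterS IH; case: (iter k _ s) => [//|y t] _.
by rewrite /= rot1_cons last_rcons.
Qed.

Lemma loop_equiv_refl : reflexive loop_equiv.
Proof. by move=> l; apply/asboolP; exists 0%N. Qed.

Lemma loop_equiv_trans : transitive loop_equiv.
Proof.
move=> l2 l1 l3 /asboolP[k e12] /asboolP[j e23]; apply/asboolP.
by exists (j + k)%N; rewrite iterD e12.
Qed.

Lemma iter_rot1_size (s : seq A) : iter (size s) (rot 1) s = s.
Proof.
suff H k : (k <= size s)%N -> iter k (rot 1) s = rot k s by rewrite H ?rot_size.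
elim: k => [|k IH] ks; first by rewrite rot0.
by rewrite iterS IH ?(ltnW ks) // -rotD ?add1n.
Qed.

Lemma loop_equiv_sym : symmetric loop_equiv.
Proof.
suff H l l' : loop_equiv l l' -> loop_equiv l' l.
  by move=> l l'; apply/idP/idP; exact: H.
move=> /asboolP[k e]; apply/asboolP.
case: l e => -[//|x s] /= ls; case/andP: (ls) => s0 /eqP lx <-.
have per n : iter (n * size s) shift_root (x :: s) = x :: s.
  elim: n => [//|n IH]; rewrite mulSn iterD IH iter_shift_root //.
  by rewrite iter_rot1_size lx.
have sp : (0 < size s)%N by rewrite lt0n size_eq0.
by exists (k * size s - k)%N; rewrite -iterD subnK ?leq_pmulr // per.
Qed.

Canonical loop_equiv_equiv :=
  EquivRel loop_equiv loop_equiv_refl loop_equiv_sym loop_equiv_trans.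

Definition unrooted_loop := {eq_quot loop_equiv}.
HB.instance Definition _ := Choice.on unrooted_loop.
HB.instance Definition _ := EqQuotient.on unrooted_loop.

(* Every quantity attached to an unrooted loop below is read off from the
   representative [repr l] and is invariant under [shift_root], so the choice of
   representative is immaterial. *)
Definition loop_word (l : unrooted_loop) : seq A := val (repr l).

Definition loop_length (l : unrooted_loop) : nat := (size (loop_word l)).-1.

Definition num_reps (l : unrooted_loop) : nat :=
  #|` fset_set [set r : rooted_loop | \pi_unrooted_loop r = l]%classic |%fset.

Definition loops_through (B : {set A}) : set unrooted_loop :=
  [set l | exists2 x, x \in B & x \in loop_word l]%classic.

(* Paths in V from x to y, as nonempty sequences [w_0; ...; w_n]. *)
Definition paths_in (V : {set A}) (x y : A) : set (seq A) :=
  [set w | exists s, [/\ w = x :: s, last x s = y & {subset w <= V}]]%classic.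

End Loops.

Section Weights.
Variables (R : realType) (A : finType) (q : A -> A -> R[i]).

(* [zip w (behead w)] lists the steps (w_{j-1}, w_j), 1 <= j <= n. *)
Definition path_weight (w : seq A) : R[i] :=
  \prod_(e <- zip w (behead w)) q e.1 e.2.

(* The matrix [f(x, y)]_{x, y in A}, rows and columns listed by [enum A]. *)
Definition mx_of (f : A -> A -> R[i]) : 'M[R[i]]_#|A| :=
  \matrix_(i, j) f (enum_val i) (enum_val j).

Definition integrable_weight : Prop :=
  spectral_radius (mx_of (fun x y => `|q x y|)) < 1.

Definition green (V : {set A}) (x y : A) : R[i] :=
  csum (paths_in V x y) path_weight.

(* F_B(A) computed from an ordering xs = [x_1; ...; x_n] of B; the recursion
   variable V runs through A_j = A \ {x_1, ..., x_{j-1}}. *)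
Fixpoint Fprod_from (V : {set A}) (xs : seq A) : R[i] :=
  if xs is x :: xs' then green V x x * Fprod_from (V :\ x) xs' else 1.

Definition Fprod (xs : seq A) : R[i] := Fprod_from [set: A] xs.

Definition loop_measure (l : unrooted_loop A) : R[i] :=
  (num_reps l)%:R * path_weight (loop_word l) / (loop_length l)%:R.

Definition loop_mass (L : set (unrooted_loop A)) : R[i] := csum L loop_measure.

End Weights.

(* Main.v *)
Require Import Defs.
From mathcomp Require Import all_boot all_order all_algebra generic_quotient.
From mathcomp Require Import finmap.
From mathcomp Require Import all_classical all_reals all_analysis.
From mathcomp Require Import complex ring lra.

(* Write [Q_V] for [Q] with the rows and columns outside [V] set to zero.
   Summing over the loops in [V] according to their root and length gives
   [m[L(V)] = \sum_n \tr (Q_V ^ n) / n].  Over the eigenvalues [r] of [Q_V] this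
   is [- \sum_r log (1 - r)], so [exp m[L(V)] = 1 / det (I - Q_V)].
   On the other side Cramer's rule turns the Neumann series into
   [G_V(x, x) = det (I - Q_(V \ x)) / det (I - Q_V)], so that [F_B(A)] telescopes
   to [det (I - Q_(A \ B)) / det (I - Q_A)]; and
   [m[L(A; B)] = m[L(A)] - m[L(A \ B)]]. *)

Set Implicit Arguments.
Unset Strict Implicit.
Unset Printing Implicit Defensive.

Import Order.TTheory GRing.Theory Num.Theory.
Import numFieldNormedType.Exports.

Local Open Scope classical_set_scope.
Local Open Scope ring_scope.
Local Open Scope complex_scope.
Local Open Scope quotient_scope.

(** Integrability bounds the eigenvalues of the matrix of [|q|] only, whereas the argument needs
    [|r| < 1] for those of every [Q_V]. The passage goes through absolute summability of the entries
    of the powers: Cayley-Hamilton gives it for [|q|], entrywise domination hands it to [Q_V], and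
    an eigenvector of [Q_V] turns it back into a bound on the eigenvalue. Spectral radii of
    different matrices are never compared. The unordered sums [csum] are computed as limits along
    finite lists of paths or loops of bounded length; the absolute sums are bounded by applying to
    [|q|] the same matrix identity that evaluates the sums for [q]. No complex logarithm occurs:
    [exp (\sum_n r ^ n / n) = 1 / (1 - r)] is proved for the sum of the series itself, which removes
    any choice of branch. *)

(** * Absolutely summable sequences *)

Section AbsSummable.
Variable K : numFieldType.
Implicit Types u v : nat -> K.

Definition abs_summable u := exists c : K, forall N, \sum_(n < N) `|u n| <= c.

Lemma abs_summable_le u v : (forall n, `|u n| <= `|v n|) ->
  abs_summable v -> abs_summable u.
Proof.
move=> uv [c vc]; exists c => N; apply: le_trans (vc N).
exact: ler_sum.
Qed.

Lemma abs_summable_sum (I : finType) (u : I -> nat -> K) :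
  (forall i, abs_summable (u i)) -> abs_summable (fun n => \sum_i u i n).
Proof.
move=> su; have [c cP] : exists c : I -> K,
    forall i N, \sum_(n < N) `|u i n| <= c i.
  have [f fP] := fin_all_exists (fun i => su i); by exists f.
exists (\sum_i c i) => N.
apply: le_trans (_ : \sum_(n < N) \sum_i `|u i n| <= _).
  by apply: ler_sum => n _; exact: ler_norm_sum.
by rewrite exchange_big; apply: ler_sum => i _; exact: cP.
Qed.

Lemma abs_summableM (c : K) u : abs_summable u -> abs_summable (fun n => c * u n).
Proof.
move=> [d ud]; exists (`|c| * d) => N.
under eq_bigr do rewrite normrM.
by rewrite -mulr_sumr; apply: ler_wpM2l.
Qed.

(** With [S N] the partial sums of [|u|], the recursion gives
    [S N <= S N.+1 <= |u 0| + |r| * S N + c], which is solved for [S N]. *)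
Lemma abs_summable_rec (r : K) u v : `|r| < 1 ->
  (forall n, u n.+1 = r * u n + v n) -> abs_summable v -> abs_summable u.
Proof.
move=> r1 uE [c vc]; exists ((`|u 0%N| + c) / (1 - `|r|)) => N.
rewrite ler_pdivlMr ?subr_gt0// mulrBr mulr1 lerBlDr.
apply: le_trans (_ : \sum_(n < N.+1) `|u n| <= _).
  by rewrite big_ord_recr /= lerDl.
rewrite big_ord_recl /= -addrA lerD2l.
apply: le_trans (_ : \sum_(n < N) (`|r| * `|u n| + `|v n|) <= _).
  by apply: ler_sum => n _; rewrite /bump /= add1n uE -normrM; exact: ler_normD.
rewrite big_split /= -mulr_sumr addrC [_ * `|r|]mulrC lerD2r; exact: vc.
Qed.

End AbsSummable.

(** * Eigenvalues, powers of a matrix, trace and determinant *)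

Section SpectralRadius.
Variable C : numClosedFieldType.

(** The left factor [B] makes the induction run: [B M ^ k] satisfies a recursion of ratio [r] with
    source [B (M - r) M ^ k], and [B (M - r)] is annihilated by one factor fewer. *)
Lemma abs_summable_annihilated n (M B : 'M[C]_n) (rs : seq C) :
  (forall r, r \in rs -> `|r| < 1) ->
  B *m (\prod_(r <- rs) (M - r%:M)) = 0 ->
  forall i j, abs_summable (fun k => (B *m M ^+ k) i j).
Proof.
elim: rs B => [|r rs IH] B rs1.
  rewrite big_nil mulmx1 => -> i j; exists 0 => N.
  by rewrite big1 // => k _; rewrite mul0mx mxE normr0.
rewrite big_cons [_ * _]/(_ *m _) mulmxA => B0 i j.
apply: (@abs_summable_rec _ r _ (fun k => (B *m (M - r%:M) *m M ^+ k) i j)).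
- by apply: rs1; rewrite mem_head.
- move=> k.
  have -> : B *m M ^+ k.+1 = r *: (B *m M ^+ k) + B *m (M - r%:M) *m M ^+ k.
    rewrite mulmxBr mulmxBl exprS [_ * _]/(_ *m _) mulmxA.
    by rewrite mul_mx_scalar -scalemxAl addrC subrK.
  by rewrite mxE; congr (_ + _); rewrite mxE.
- by apply: IH => // s srs; apply: rs1; rewrite in_cons srs orbT.
Qed.

(* By Cayley-Hamilton the product of the [M - r] over the roots [r] of the
   characteristic polynomial vanishes; its factors are peeled off one by one. *)
Lemma abs_summable_expmx n (M : 'M[C]_n) :
  (forall z, eigenvalue M z -> `|z| < 1) ->
  forall i j, abs_summable (fun k => (M ^+ k) i j).
Proof.
case: n M => [M _ []//|n M M1] i j.
have [rs rsE] := closed_field_poly_normal (char_poly M).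
rewrite (monicP (char_poly_monic M)) scale1r in rsE.
have := @abs_summable_annihilated _ M 1%:M rs _ _ i j.
have -> : (fun k => (1%:M *m M ^+ k) i j) = fun k => (M ^+ k) i j.
  by apply: funext => k; rewrite mul1mx.
apply.
  move=> r rrs; apply: M1; rewrite eigenvalue_root_char rsE.
  by rewrite root_prod_XsubC.
rewrite mul1mx -(Cayley_Hamilton M) rsE rmorph_prod /=.
by apply: eq_bigr => r _; rewrite rmorphB /= horner_mx_X horner_mx_C.
Qed.

Lemma mulmx_trig (R : pzSemiRingType) n (A B : 'M[R]_n) :
  is_trig_mx A -> is_trig_mx B ->
  is_trig_mx (A *m B) /\ forall i, (A *m B) i i = A i i * B i i.
Proof.
move=> /is_trig_mxP tA /is_trig_mxP tB; split=> [|i].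
  apply/is_trig_mxP => i j ij; rewrite mxE big1 // => k _.
  have [ik|ki] := ltnP i k; first by rewrite tA ?mul0r.
  by rewrite tB ?mulr0 // (leq_ltn_trans ki).
rewrite mxE (bigD1 i) //= big1 ?addr0 // => k ki.
have [ik|ik] := ltnP i k; first by rewrite tA ?mul0r.
by rewrite tB ?mulr0 // ltn_neqAle ik andbT.
Qed.

Lemma expmx_trig (R : pzSemiRingType) n (A : 'M[R]_n) k : is_trig_mx A ->
  is_trig_mx (A ^+ k) /\ forall i, (A ^+ k) i i = A i i ^+ k.
Proof.
move=> tA; elim: k => [|k [tk dk]].
  split=> [|i]; last by rewrite mxE eqxx.
  by apply/is_trig_mxP => i j ij; rewrite mxE -val_eqE ltn_eqF.
have [t d] := mulmx_trig tA tk; rewrite exprS.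
by split=> // i; rewrite d dk exprS.
Qed.

(** Schur's theorem makes [M] similar to a triangular [T], and [rs] is the diagonal of [T], hence
    counts multiplicities. Similarity preserves the determinant and the traces of all powers, so one
    family serves both formulas. *)
Lemma trace_det_eigen n (M : 'M[C]_n) :
  exists rs : 'I_n -> C, [/\ forall i, eigenvalue M (rs i),
    \det (1%:M - M) = \prod_i (1 - rs i) &
    forall k, \tr (M ^+ k) = \sum_i rs i ^+ k].
Proof.
case: n M => [M|n M].
  exists (fun=> 0); split=> [[]//||k]; first by rewrite det_mx00 big_ord0.
  by rewrite /mxtrace !big_ord0.
have [P /unitarymx_unit uP] := Schur M isT.
move=> simT; have trT : is_trig_mx (conjmx P M) := simT.
have TE : conjmx P M = P *m M *m invmx P by rewrite conjumx.
have eT i : eigenvalue M (conjmx P M i i).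
  apply: (@eigenvalue_conjmx _ _ _ P).
  - by rewrite submx_full // row_full_unit.
  - by rewrite row_free_unit.
  rewrite [_ \in _]eigenvalue_root_char char_poly_trig //.
  by rewrite (bigD1 i) //= rootM root_XsubC eqxx.
move: (conjmx P M) trT TE eT => T trT TE eT.
exists (fun i => T i i); split=> // [|k].
- have -> : \det (1%:M - M) = \det (1%:M - T).
    have -> : 1%:M - T = P *m (1%:M - M) *m invmx P.
      by rewrite TE mulmxBr mulmxBl mulmx1 mulmxV.
    by rewrite !det_mulmx mulrAC -det_mulmx mulmxV // det1 mul1r.
  rewrite det_trig; first by apply: eq_bigr => i _; rewrite !mxE eqxx.
  apply/is_trig_mxP => i j ij; rewrite !mxE -val_eqE ltn_eqF //.
  by rewrite (is_trig_mxP trT) ?subr0.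
have [_ d] := expmx_trig k trT.
rewrite -(eq_bigr _ (fun i _ => d i)).
suff -> : T ^+ k = P *m M ^+ k *m invmx P.
  by rewrite -/(mxtrace _) mxtrace_mulC mulmxA mulVmx // mul1mx.
elim: k {d} => [|k IH]; first by rewrite !expr0 mulmx1 mulmxV.
rewrite !exprS IH TE -!mulmxE !mulmxA.
by rewrite -(mulmxA (P *m M) (invmx P) P) mulVmx // mulmx1.
Qed.

End SpectralRadius.

(** On an eigenvector [v] the powers act by [z ^ k]. If [|z| >= 1], each term of the summable
    sequence [(v M ^ k)_j] has modulus at least [|v_j| > 0], so the partial sums exceed every
    bound. *)
Lemma eigenvalue_abs_summable (R : realType) n (M : 'M[R[i]]_n) z :
  (forall i j, abs_summable (fun k => (M ^+ k) i j)) ->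
  eigenvalue M z -> `|z| < 1.
Proof.
move=> sM /eigenvalueP[v vM v0].
have vMk k : v *m M ^+ k = z ^+ k *: v.
  elim: k => [|k IH]; first by rewrite !expr0 mulmx1 scale1r.
  rewrite exprSr [_ * _]/(_ *m _) mulmxA IH -scalemxAl vM scalerA.
  by rewrite exprSr.
have /rV0Pn[j vj0] := v0.
have [c sc] : abs_summable (fun k => \sum_i v 0 i * (M ^+ k) i j).
  by apply: abs_summable_sum => i; exact: abs_summableM.
have c0 : 0 <= c by apply: le_trans (sc 0%N); rewrite big_ord0.
have vj : 0 < `|v 0 j| by rewrite normr_gt0.
rewrite real_ltNge ?num_real //; apply/negP => z1.
have le N : N%:R * `|v 0 j| <= c.
  apply: le_trans (sc N); rewrite mulr_natl -[X in _ *+ X]card_ord -sumr_const.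
  apply: ler_sum => k _.
  have -> : \sum_i v 0 i * (M ^+ k) i j = (v *m M ^+ k) 0 j by rewrite mxE.
  rewrite vMk mxE normrM normrX ler_peMl //; exact: exprn_ege1.
have [m mP] : exists m : nat, c / `|v 0 j| < m%:R.
  have cv0 : 0 <= c / `|v 0 j| by rewrite divr_ge0.
  (* A nonnegative element of [R[i]] has zero imaginary part, so the integer can be found in [R]. *)
  exists (Num.truncn (complex.Re (c / `|v 0 j|))).+1.
  move: cv0; case: (c / _) => a b; rewrite lecE /= => /andP[/eqP -> a0].
  rewrite -(rmorph_nat (real_complex R)) ltcE /= eqxx /=.
  exact: truncnS_gt.
by have := le m; rewrite -ler_pdivlMr // => /(lt_le_trans mP); rewrite ltxx.
Qed.


(** * Coordinatewise limits and the exponential in [R[i]] *)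

Section ComplexLimits.
Variable R : realType.
Implicit Types (u v : nat -> R[i]) (l : R[i]).
Notation Re := complex.Re.
Notation Im := complex.Im.

Lemma ReD (x y : R[i]) : Re (x + y) = Re x + Re y. Proof. by case: x; case: y. Qed.
Lemma ImD (x y : R[i]) : Im (x + y) = Im x + Im y. Proof. by case: x; case: y. Qed.

Lemma Re_sum (I : Type) (s : seq I) (P : pred I) (F : I -> R[i]) :
  Re (\sum_(i <- s | P i) F i) = \sum_(i <- s | P i) Re (F i).
Proof. exact: (big_morph _ ReD). Qed.

Lemma Im_sum (I : Type) (s : seq I) (P : pred I) (F : I -> R[i]) :
  Im (\sum_(i <- s | P i) F i) = \sum_(i <- s | P i) Im (F i).
Proof. exact: (big_morph _ ImD). Qed.

Lemma Re_norm_le (z : R[i]) : `|Re z| <= Re `|z|.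
Proof. by have := normc_ge_Re z; rewrite lecE => /andP[]. Qed.

Lemma Im_norm_le (z : R[i]) : `|Im z| <= Re `|z|.
Proof.
case: z => a b; have := Re_norm_le ((a +i* b) * 'i).
have i1 : `|'i : R[i]| = 1 by rewrite normc_def /= expr0n expr1n add0r sqrtr1.
by rewrite normrM i1 mulr1 ReiNIm normrN.
Qed.

(** Coordinatewise, because [csum] and [cexp] are themselves given by real and imaginary parts. *)
Definition ccvg u l :=
  (fun n => Re (u n)) @ \oo --> Re l /\ (fun n => Im (u n)) @ \oo --> Im l.

Lemma ccvg_unique u l l' : ccvg u l -> ccvg u l' -> l = l'.
Proof.
case: l l' => [a b] [a' b'] [/= ra ib] [/= ra' ib'].
congr (_ +i* _); first exact: (cvg_unique (@Rhausdorff R) ra ra').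
exact: (cvg_unique (@Rhausdorff R) ib ib').
Qed.

Lemma ccvg_cst l : ccvg (fun=> l) l.
Proof. by split; exact: cvg_cst. Qed.

Lemma ccvgD u v l m : ccvg u l -> ccvg v m -> ccvg (fun n => u n + v n) (l + m).
Proof.
move=> [ru iu] [rv iv]; split.
  rewrite ReD; under eq_fun do rewrite ReD; exact: cvgD.
rewrite ImD; under eq_fun do rewrite ImD; exact: cvgD.
Qed.

Lemma ccvgMl c u l : ccvg u l -> ccvg (fun n => c * u n) (c * l).
Proof.
move=> [ru iu].
have ReM (x y : R[i]) : Re (x * y) = Re x * Re y - Im x * Im y by case: x; case: y.
have ImM (x y : R[i]) : Im (x * y) = Re x * Im y + Im x * Re y by case: x; case: y.
split.
  by rewrite ReM; under eq_fun do rewrite ReM; apply: cvgB; exact: cvgMr.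
by rewrite ImM; under eq_fun do rewrite ImM; apply: cvgD; exact: cvgMr.
Qed.

Lemma ccvg_sum (I : Type) (s : seq I) (P : pred I) (F : I -> nat -> R[i])
    (l : I -> R[i]) :
  (forall i, ccvg (F i) (l i)) ->
  ccvg (fun n => \sum_(i <- s | P i) F i n) (\sum_(i <- s | P i) l i).
Proof.
move=> Fl; elim: s => [|i s IH].
  by rewrite big_nil; under eq_fun do rewrite big_nil; exact: ccvg_cst.
rewrite big_cons; under eq_fun do rewrite big_cons.
by case: (P i); first exact: ccvgD.
Qed.

Lemma abs_summable_ccvg u : abs_summable u ->
  exists l, ccvg (fun N => \sum_(n < N) u n) l.
Proof.
move=> [c uc].
have H (p : R[i] -> R) : (forall z, `|p z| <= Re `|z|) ->
    cvgn (series (fun n => p (u n))).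
  move=> pz; apply: normed_cvg; apply: nondecreasing_is_cvgn.
    by apply: nondecreasing_series => n _ _; exact: normr_ge0.
  exists (Re c) => _ [N _ <-]; rewrite /= /series /= big_mkord.
  have := uc N; rewrite lecE => /andP[_]; apply: le_trans.
  by rewrite Re_sum; apply: ler_sum => n _; exact: pz.
have /H/cvg_ex[a ca] := Re_norm_le.
have /H/cvg_ex[b cb] := Im_norm_le.
exists (a +i* b); split=> /=.
  under eq_fun do rewrite Re_sum.
  apply: cvg_trans ca; rewrite /series /=.
  by under [X in _ `=>` X @ _]eq_fun do rewrite big_mkord.
under eq_fun do rewrite Im_sum.
apply: cvg_trans cb; rewrite /series /=.
by under [X in _ `=>` X @ _]eq_fun do rewrite big_mkord.
Qed.

Lemma cexpD (z w : R[i]) : cexp (z + w) = cexp z * cexp w.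
Proof.
case: z w => [a b] [c d]; apply/eqP; rewrite eq_complex /= expRD cosD sinD.
by apply/andP; split; apply/eqP; ring.
Qed.

Lemma cexp0 : cexp 0 = 1 :> R[i].
Proof. by rewrite /cexp /= expR0 cos0 sin0 mulr0 mulr1. Qed.

Lemma cexp_sum (I : Type) (s : seq I) (P : pred I) (F : I -> R[i]) :
  cexp (\sum_(i <- s | P i) F i) = \prod_(i <- s | P i) cexp (F i).
Proof. exact: (big_morph _ cexpD cexp0). Qed.

Lemma cexpN (z : R[i]) : cexp (- z) = (cexp z)^-1.
Proof.
have h : cexp z * cexp (- z) = 1 by rewrite -cexpD subrr cexp0.
have z0 : cexp z != 0.
  by apply: contra_eq_neq h => ->; rewrite mul0r eq_sym oner_eq0.
by apply: (mulfI z0); rewrite h mulfV.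
Qed.

End ComplexLimits.

(** * The exponential of the logarithmic series *)

Section LogSeries.
Variable R : realType.
Notation Re := complex.Re.
Notation Im := complex.Im.
Variable z : R[i].
Hypothesis z1 : `|z| < 1.

Let r := Re `|z|.
Let x n := Re (z ^+ n.+1).
Let y n := Im (z ^+ n.+1).

(** For [c = x] and [c = y] these are the real and imaginary parts of the truncated series of
    [- log (1 - t z)], as polynomials in the real variable [t]. *)
Definition log_poly (c : nat -> R) N : {poly R} :=
  \sum_(n < N) (c n / n.+1%:R) *: 'X^(n.+1).

Let a := log_poly x.
Let b := log_poly y.

Lemma log_polyE c N t : (log_poly c N).[t] = \sum_(n < N) c n / n.+1%:R * t ^+ n.+1.
Proof.
by rewrite horner_sum; apply: eq_bigr => n _; rewrite hornerZ hornerXn.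
Qed.

Lemma log_poly0 c N : (log_poly c N).[0] = 0.
Proof. by rewrite log_polyE big1 // => n _; rewrite expr0n mulr0. Qed.

Lemma deriv_log_polyE c N t : (log_poly c N)^`().[t] = \sum_(n < N) c n * t ^+ n.
Proof.
rewrite raddf_sum horner_sum; apply: eq_bigr => n _ /=.
rewrite derivZ derivXn hornerZ hornerMn hornerXn /= -[t ^+ n *+ _]mulr_natr.
by rewrite [X in _ * X]mulrC mulrA divfK // pnatr_eq0.
Qed.

Let xS n : x n.+1 = Re z * x n - Im z * y n.
Proof. by rewrite /x /y exprS; case: z (z ^+ _) => ? ? [? ?]. Qed.

Let yS n : y n.+1 = Re z * y n + Im z * x n.
Proof. by rewrite /x /y exprS; case: z (z ^+ _) => ? ? [? ?]. Qed.

(** [geomRe] and [geomIm] are the two coordinates of the finite geometric sum [(1 - t z) * \sum_(n <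
    N) t ^ n z ^ n.+1 = z - t ^ N z ^ N.+1]. *)
Let geomRe N t : (1 - t * Re z) * (a N)^`().[t] + t * Im z * (b N)^`().[t] =
  Re z - x N * t ^+ N.
Proof.
rewrite !deriv_log_polyE; elim: N => [|N IH].
  by rewrite !big_ord0 /x expr1; ring.
rewrite !big_ord_recr /= xS exprS.
rewrite [LHS](_ : _ = (1 - t * Re z) * (\sum_(i < N) x i * t ^+ i) +
  t * Im z * (\sum_(i < N) y i * t ^+ i) + x N * t ^+ N
  - (Re z * x N - Im z * y N) * (t * t ^+ N)); last by ring.
by rewrite IH; ring.
Qed.

Let geomIm N t : (1 - t * Re z) * (b N)^`().[t] - t * Im z * (a N)^`().[t] =
  Im z - y N * t ^+ N.
Proof.
rewrite !deriv_log_polyE; elim: N => [|N IH].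
  by rewrite !big_ord0 /y expr1; ring.
rewrite !big_ord_recr /= yS exprS.
rewrite [LHS](_ : _ = (1 - t * Re z) * (\sum_(i < N) y i * t ^+ i) -
  t * Im z * (\sum_(i < N) x i * t ^+ i) + y N * t ^+ N
  - (Re z * y N + Im z * x N) * (t * t ^+ N)); last by ring.
by rewrite IH; ring.
Qed.

Let r0 : 0 <= r.
Proof. exact: le_trans (normr_ge0 _) (Re_norm_le z). Qed.

Let rE n : Re `|z ^+ n| = r ^+ n.
Proof.
rewrite normrX; elim: n => [|n IH]; first by rewrite !expr0.
rewrite !exprS -IH /r normc_def; case: (_ ^+ n) => u v /=.
by rewrite mul0r subr0.
Qed.

Let r1 : r < 1.
Proof. by have := z1; rewrite ltcE => /andP[]. Qed.

Let x_le n : `|x n| <= r ^+ n.+1.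
Proof. by rewrite -rE; exact: Re_norm_le. Qed.

Let y_le n : `|y n| <= r ^+ n.+1.
Proof. by rewrite -rE; exact: Im_norm_le. Qed.

Let geom_le N : \sum_(n < N) r ^+ n.+1 <= (1 - r)^-1.
Proof.
rewrite -[leRHS]mul1r ler_pdivlMr ?subr_gt0 //.
have -> : (\sum_(n < N) r ^+ n.+1) * (1 - r) = r - r ^+ N.+1.
  elim: N => [|N IH]; first by rewrite big_ord0 expr1 mul0r subrr.
  by rewrite big_ord_recr /= mulrDl IH [r ^+ N.+2]exprS; ring.
have := exprn_ge0 N.+1 r0; have := r1; lra.
Qed.

(** Only the real part of the exponent has to be bounded, since [|exp (A + i B)| = exp A]; the bound
    is uniform in [N] and [t]. *)
Let a_le N t : 0 <= t <= 1 -> (a N).[t] <= (1 - r)^-1.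
Proof.
move=> /andP[t0 t1]; apply: le_trans (geom_le N).
rewrite log_polyE; apply: ler_sum => n _.
apply: le_trans (ler_norm _) _; rewrite !normrM.
rewrite -[leRHS]mulr1 -[leRHS]mulr1 !ler_pM ?normr_ge0 ?mulr_ge0 //.
  by rewrite normfV ger0_norm // invf_le1 ?ltr0n // ler1n.
by rewrite normrX ger0_norm // exprn_ile1.
Qed.

(** Serves both derivatives in [is_derive_h], where [u] and [v] are [x N] and [y N] up to sign and
    order. *)
Let bound_le N (A B u v t : R) : 0 <= t <= 1 -> A <= (1 - r)^-1 ->
  `|u| <= r ^+ N.+1 -> `|v| <= r ^+ N.+1 ->
  `|expR A * (cos B * (u * t ^+ N) + sin B * (v * t ^+ N))| <=
    expR (1 - r)^-1 * (r ^+ N.+1 + r ^+ N.+1).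
Proof.
move=> /andP[t0 t1] Ac ur vr; rewrite normrM ler_pM ?normr_ge0 //.
  by rewrite ger0_norm ?expR_ge0 // ler_expR.
have tN : `|t ^+ N| <= 1 by rewrite normrX ger0_norm // exprn_ile1.
apply: le_trans (ler_normD _ _) _; rewrite !normrM.
have le1 (p q s w : R) : 0 <= p <= 1 -> 0 <= q <= w -> 0 <= s <= 1 ->
    p * (q * s) <= w.
  move=> /andP[p0 p1] /andP[q0 qw] /andP[s0 s1].
  rewrite -[leRHS]mul1r ler_pM ?mulr_ge0 //.
  by rewrite -[leRHS]mulr1 ler_pM.
by apply: lerD; apply: le1; rewrite normr_ge0 /= ?cos_max ?sin_max.
Qed.

Let derivable_continuous (f df : R -> R) :
  (forall t, is_derive t (1 : R) f (df t)) ->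
  {within `[0, 1], continuous f}.
Proof.
move=> fd; apply: continuous_subspaceT => t.
by apply/differentiable_continuous/derivable1_diffP; case: (fd t).
Qed.

(* Real and imaginary part of
   [h t = (1 - t z) exp (\sum_(n < N) t ^ n.+1 z ^ n.+1 / n.+1)].  Here [h 0 = 1],
   and the derivative [- t ^ N z ^ N.+1 exp (...)] tends to 0 uniformly on
   [[0, 1]], so that [h 1] tends to 1. *)
Let hRe N t := (1 - t * Re z) * (expR (a N).[t] * cos (b N).[t]) +
  t * Im z * (expR (a N).[t] * sin (b N).[t]).

Let hIm N t := (1 - t * Re z) * (expR (a N).[t] * sin (b N).[t]) -
  t * Im z * (expR (a N).[t] * cos (b N).[t]).

Let is_derive_h N t :
  is_derive t (1 : R) (hRe N) (expR (a N).[t] *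
    (cos (b N).[t] * (- x N * t ^+ N) + sin (b N).[t] * (y N * t ^+ N))) /\
  is_derive t (1 : R) (hIm N) (expR (a N).[t] *
    (cos (b N).[t] * (- y N * t ^+ N) + sin (b N).[t] * (- x N * t ^+ N))).
Proof.
have dE := @is_derive1_comp R (@expR R) (horner (a N)) t _ _
  (is_derive_expR _) (is_derive_poly _ _).
have dC := @is_derive1_comp R (@cos R) (horner (b N)) t _ _
  (is_derive_cos _) (is_derive_poly _ _).
have dS := @is_derive1_comp R (@sin R) (horner (b N)) t _ _
  (is_derive_sin _) (is_derive_poly _ _).
have dl : is_derive t (1 : R) (fun t => 1 - t * Re z) (- Re z).
  have := is_deriveB (is_derive_cst (1 : R) t (1 : R))
    (is_deriveM (is_derive_id t (1 : R)) (is_derive_cst (Re z) t (1 : R))).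
  by move=> h; apply: (is_derive_eq h); rewrite /GRing.scale /=; ring.
have dr : is_derive t (1 : R) (fun t => t * Im z) (Im z).
  have := is_deriveM (is_derive_id t (1 : R)) (is_derive_cst (Im z) t (1 : R)).
  by move=> h; apply: (is_derive_eq h); rewrite /GRing.scale /=; ring.
(* Once [t ^ N z ^ N.+1] is expanded by the geometric sum, both claims are instances of the product
   rule that [ring] can check. *)
have -> : - x N * t ^+ N =
    (1 - t * Re z) * (a N)^`().[t] + t * Im z * (b N)^`().[t] - Re z.
  by rewrite geomRe; ring.
have yE : y N * t ^+ N =
    Im z - ((1 - t * Re z) * (b N)^`().[t] - t * Im z * (a N)^`().[t]).
  by rewrite geomIm; ring.
rewrite mulNr yE; split.
  have h := is_deriveD (is_deriveM dl (is_deriveM dE dC))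
    (is_deriveM dr (is_deriveM dE dS)).
  by apply: (is_derive_eq h); rewrite /GRing.scale /= !fctE /=; ring.
have h := is_deriveB (is_deriveM dl (is_deriveM dE dS))
  (is_deriveM dr (is_deriveM dE dC)).
by apply: (is_derive_eq h); rewrite /GRing.scale /= !fctE /=; ring.
Qed.

(** The mean value theorem has no equality form for complex values, which is why [h] is treated one
    coordinate at a time. *)
Let le_of_deriv (f df : R -> R) K : (forall t, is_derive t (1 : R) f (df t)) ->
  (forall t, 0 <= t <= 1 -> `|df t| <= K) -> `|f 1 - f 0| <= K.
Proof.
move=> fd dK; have [t] := MVT_segment ler01 (fun t _ => fd t) (derivable_continuous fd).
by rewrite in_itv /= subr0 mulr1 => t01 ->; exact: dK.
Qed.

Let cvg_of_bound (f : nat -> R) (k : R) :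
  (forall N, `|f N - k| <= expR (1 - r)^-1 * (r ^+ N.+1 + r ^+ N.+1)) ->
  f @ \oo --> k.
Proof.
move=> fk; set e := fun N => expR (1 - r)^-1 * (r ^+ N.+1 + r ^+ N.+1).
have e0 : e @ \oo --> (0 : R).
  have rS : (fun N => r ^+ N.+1) @ \oo --> (0 : R).
    by rewrite (@cvg_shiftS _ (GRing.exp r)); apply: cvg_expr; rewrite ger0_norm.
  rewrite (_ : 0 = expR (1 - r)^-1 * (0 + 0)); last by rewrite addr0 mulr0.
  by apply: cvgMr; exact: cvgD.
have ck : (fun _ : nat => k) @ \oo --> k by exact: cvg_cst.
apply: (@squeeze_cvgr _ _ _ _ (fun N => k - e N) (fun N => k + e N)).
- by near=> N; have := fk N; rewrite ler_distl.
- suff: k - e N @[N --> \oo] --> k - 0 by rewrite subr0.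
  exact: cvgB.
- suff: k + e N @[N --> \oo] --> k + 0 by rewrite addr0.
  exact: cvgD.
Unshelve. all: by end_near. Qed.

Lemma cexp_log_series : exists2 L,
  ccvg (fun N => \sum_(n < N) z ^+ n.+1 / n.+1%:R) L & cexp L = (1 - z)^-1.
Proof.
have sz : abs_summable (fun n => z ^+ n.+1 / n.+1%:R).
  apply: (@abs_summable_le _ _ (fun n => z ^+ n.+1)) => [n|].
    rewrite normrM normfV normr_nat ler_piMr // invf_le1 ?ltr0n //.
    by rewrite ler1n.
  apply: (@abs_summable_rec _ z _ (fun=> 0)) => //.
    by move=> n; rewrite addr0 exprS.
  by exists 0 => N; rewrite big1 // => i _; rewrite normr0.
have [L cL] := abs_summable_ccvg sz; exists L => //.
have := cL; case=> cA cB.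
have termE n : z ^+ n.+1 / n.+1%:R = (x n / n.+1%:R) +i* (y n / n.+1%:R).
  rewrite -(rmorph_nat (real_complex R)) -fmorphV /x /y.
  case: (z ^+ _) => u v; apply/eqP; rewrite eq_complex /=.
  by apply/andP; split; apply/eqP; ring.
have {}cA : (fun N => (a N).[1]) @ \oo --> Re L.
  apply: cvg_trans cA; apply: near_eq_cvg; near=> N.
  rewrite Re_sum log_polyE; apply: eq_bigr => n _.
  by rewrite termE expr1n mulr1.
have {}cB : (fun N => (b N).[1]) @ \oo --> Im L.
  apply: cvg_trans cB; apply: near_eq_cvg; near=> N.
  rewrite Im_sum log_polyE; apply: eq_bigr => n _.
  by rewrite termE expr1n mulr1.
have cE : (fun N => expR (a N).[1]) @ \oo --> expR (Re L).
  by apply: continuous_cvg => //; exact: continuous_expR.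
have cC : (fun N => cos (b N).[1]) @ \oo --> cos (Im L).
  by apply: continuous_cvg => //; exact: continuous_cos.
have cS : (fun N => sin (b N).[1]) @ \oo --> sin (Im L).
  by apply: continuous_cvg => //; exact: continuous_sin.
have hR1 : hRe^~ 1 @ \oo --> (1 : R).
  apply: cvg_of_bound => N.
  have h0 : hRe N 0 = 1 by rewrite /hRe !log_poly0 expR0 cos0; ring.
  rewrite -[X in _ - X]h0.
  apply: (le_of_deriv (fun t => (is_derive_h N t).1)) => t t01.
  by apply: bound_le; rewrite ?normrN ?a_le.
have hI1 : hIm^~ 1 @ \oo --> (0 : R).
  apply: cvg_of_bound => N.
  have h0 : hIm N 0 = 0 by rewrite /hIm !log_poly0 expR0 sin0; ring.
  rewrite -[X in _ - X]h0.
  apply: (le_of_deriv (fun t => (is_derive_h N t).2)) => t t01.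
  by apply: bound_le; rewrite ?normrN ?a_le.
have hR2 : hRe^~ 1 @ \oo --> (1 - 1 * Re z) * (expR (Re L) * cos (Im L)) +
    1 * Im z * (expR (Re L) * sin (Im L)).
  by apply: cvgD; apply: cvgMr; apply: cvgM.
have hI2 : hIm^~ 1 @ \oo --> (1 - 1 * Re z) * (expR (Re L) * sin (Im L)) -
    1 * Im z * (expR (Re L) * cos (Im L)).
  by apply: cvgB; apply: cvgMr; apply: cvgM.
(* The limit of [h 1] is [1] by the derivative bound and [(1 - z) exp L] by continuity. *)
have eR := cvg_unique (@Rhausdorff R) hR1 hR2.
have eI := cvg_unique (@Rhausdorff R) hI1 hI2.
have e1 : (1 - z) * cexp L = 1.
  clear -eR eI; case: z L eR eI => u v [A B] /= eR eI.
  apply/eqP; rewrite eq_complex /= [X in _ == X]eR [X in _ && (_ == X)]eI.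
  by apply/andP; split; apply/eqP; ring.
have nz : 1 - z != 0 
  by rewrite subr_eq0 eq_sym; apply: contraTneq z1 => ->; rewrite normr1 ltxx.
by apply: (mulfI nz); rewrite e1 mulfV.
Unshelve. all: by end_near. Qed.
End LogSeries.

(** * Unordered sums as limits along increasing finite lists *)

Section Exhaustion.
Variables (R : realType) (I : choiceType) (D : set I) (E : nat -> seq I).
Hypothesis E_uniq : forall N, uniq (E N).
Hypothesis E_sub : forall N i, i \in E N -> D i.
Hypothesis E_incr : forall N, {subset E N <= E N.+1}.
Hypothesis E_cover : forall i, D i -> exists N, i \in E N.

Let E_mono m n : (m <= n)%N -> {subset E m <= E n}.
Proof.
elim: n => [|n IH]; first by rewrite leqn0 => /eqP ->.
by rewrite leq_eqVlt => /predU1P[-> //|/IH sub] i /sub /E_incr.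
Qed.

Let E_finite (s : seq I) : (forall i, i \in s -> D i) -> exists N, {subset s <= E N}.
Proof.
elim: s => [_|i s IH sD]; first by exists 0%N.
have [n sn] : exists N, {subset s <= E N}.
  by apply: IH => j js; apply: sD; rewrite in_cons js orbT.
have [m im] := E_cover (sD i (mem_head i s)).
exists (maxn m n) => j; rewrite in_cons => /predU1P[->|/sn].
  by apply: E_mono im; exact: leq_maxl.
by apply: E_mono; exact: leq_maxr.
Qed.

Let ler_sum_subset (g : I -> R) (s t : seq I) : uniq s -> uniq t -> {subset s <= t} ->
  (forall i, 0 <= g i) -> \sum_(i <- s) g i <= \sum_(i <- t) g i.
Proof.
move=> us ut st g0; rewrite [leRHS](bigID (mem s)) /=.
have -> : \sum_(i <- t | i \in s) g i = \sum_(i <- s) g i.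
  rewrite -big_filter; apply: perm_big; apply: uniq_perm => //.
    exact: filter_uniq.
  by move=> i; rewrite mem_filter; case: (boolP (i \in s)) => // /st ->.
by rewrite lerDl sumr_ge0.
Qed.

(** Every finite subset of [D] lies in some [E N], so the supremum over finite subsets is already
    attained along the lists. The bound [c] makes it finite, so that [fine] returns the true
    value. *)
Lemma esum_exhaustion (g : I -> R) c : (forall i, 0 <= g i) ->
  (forall N, \sum_(i <- E N) g i <= c) ->
  (fun N => \sum_(i <- E N) g i) @ \oo --> fine (esum D (fun i => (g i)%:E)).
Proof.
move=> g0 gc; set u := fun N => _.
have ubu : has_ubound (range u) by exists c => _ [N _ <-]; exact: gc.
have cvgu : u @ \oo --> sup (range u).
  apply: nondecreasing_cvgn => //; apply/nondecreasing_seqP => n.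
  by apply: ler_sum_subset => //; exact: E_incr.
suff -> : esum D (fun i => (g i)%:E) = (sup (range u))%:E by [].
have u_le N : ((u N)%:E <= esum D (fun i => (g i)%:E))%E.
  apply: esum_ge; exists [set` E N].
    by split; [exact: finite_seq|move=> i /E_sub].
  by rewrite -fsbig_seq // sumEFin.
have le_sup : (esum D (fun i => (g i)%:E) <= (sup (range u))%:E)%E.
  apply: ge_ereal_sup => _ [X [/finite_fsetP[Y ->] YD] <-].
  rewrite -fsbig_seq ?fset_uniq // sumEFin lee_fin.
  have [N sN] := E_finite YD.
  apply: le_trans (_ : u N <= _).
    by apply: ler_sum_subset => //; exact: fset_uniq.
  by apply: ub_le_sup => //; exists N.
apply/eqP; rewrite eq_le le_sup /=.
have fin : esum D (fun i => (g i)%:E) \is a fin_num.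
  rewrite fin_numE; apply/andP; split; apply/eqP => e.
    by have := u_le 0%N; rewrite e leeNy_eq.
  by move: le_sup; rewrite e leye_eq.
rewrite -(fineK fin) lee_fin; apply: ge_sup; first by exists (u 0%N), 0%N.
by move=> _ [N _ <-]; rewrite -lee_fin fineK.
Qed.

Lemma rsum_exhaustion (f : I -> R) c : (forall N, \sum_(i <- E N) `|f i| <= c) ->
  (fun N => \sum_(i <- E N) f i) @ \oo --> rsum D f.
Proof.
move=> fc; have H (p : R -> R) : (forall x, 0 <= p x <= `|x|) ->
    (fun N => \sum_(i <- E N) p (f i)) @ \oo --> fine (esum D (fun i => (p (f i))%:E)).
  move=> pP; apply: (@esum_exhaustion _ c) => [i|N]; first by case/andP: (pP (f i)).
  apply: le_trans (fc N); apply: ler_sum => i _; by case/andP: (pP (f i)).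
have maxP (x : R) : 0 <= Num.max x 0 <= `|x|.
  by rewrite le_max lexx orbT ge_max ler_norm normr_ge0.
have hp := H (fun x => Num.max x 0) maxP.
have maxNP (x : R) : 0 <= Num.max (- x) 0 <= `|x| by rewrite -normrN; exact: maxP.
have hn := H (fun x => Num.max (- x) 0) maxNP.
have -> : (fun N => \sum_(i <- E N) f i) = (fun N =>
    \sum_(i <- E N) Num.max (f i) 0 - \sum_(i <- E N) Num.max (- f i) 0).
  apply: funext => N; rewrite -sumrB; apply: eq_bigr => i _.
  by case: (lerP (f i) 0); case: (lerP (- f i) 0); lra.
exact: cvgB.
Qed.

Lemma csum_exhaustion (f : I -> R[i]) (c : R[i]) :
  (forall N, \sum_(i <- E N) `|f i| <= c) ->
  ccvg (fun N => \sum_(i <- E N) f i) (csum D f).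
Proof.
move=> fc.
have H (p : R[i] -> R) : (forall z, `|p z| <= complex.Re `|z|) ->
    (fun N => \sum_(i <- E N) p (f i)) @ \oo --> rsum D (fun i => p (f i)).
  move=> pz; apply: (@rsum_exhaustion _ (complex.Re c)) => N.
  have := fc N; rewrite lecE => /andP[_]; apply: le_trans.
  by rewrite Re_sum; apply: ler_sum => i _; exact: pz.
split=> /=.
  by under eq_fun do rewrite Re_sum; apply: H; exact: Re_norm_le.
by under eq_fun do rewrite Im_sum; apply: H; exact: Im_norm_le.
Qed.

End Exhaustion.

(** * Enumeration of words by length *)

Section Words.
Variable A : finType.

Fixpoint words n : seq (seq A) :=
  if n is m.+1 then [seq a :: s | a <- enum A, s <- words m] else [:: [::]].

Lemma mem_words n s : (s \in words n) = (size s == n).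
Proof.
elim: n s => [|n IH] [|a s] //=.
  by apply/allpairsP => -[[b t]] [].
apply/allpairsP/idP => [[[b t]] /= [_ tn [_ ->]]|sn]; first by rewrite eqSS -IH.
by exists (a, s); rewrite mem_enum IH.
Qed.

Lemma words_uniq n : uniq (words n).
Proof.
elim: n => [//|n IH]; apply: allpairs_uniq => //; first exact: enum_uniq.
by move=> [a s] [b t] _ _ [/= ab st]; rewrite ab st.
Qed.

Fixpoint words_lt n : seq (seq A) :=
  if n is m.+1 then words_lt m ++ words m else [::].

Lemma mem_words_lt n s : (s \in words_lt n) = (size s < n)%N.
Proof.
by elim: n => [//|n IH] /=; rewrite mem_cat IH mem_words ltnS [RHS]leq_eqVlt orbC.
Qed.

Lemma words_lt_uniq n : uniq (words_lt n).
Proof.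
elim: n => [//|n IH] /=; rewrite cat_uniq IH words_uniq andbT /=.
by apply/hasPn => s; rewrite mem_words mem_words_lt => /eqP ->; rewrite ltnn.
Qed.

Lemma big_words_lt (V : nmodType) n (P : pred (seq A)) (F : seq A -> V) :
  \sum_(s <- words_lt n | P s) F s = \sum_(k < n) \sum_(s <- words k | P s) F s.
Proof.
by elim: n => [|n IH]; rewrite ?big_nil ?big_ord0 //= big_cat IH big_ord_recr.
Qed.

Lemma big_wordsS (V : nmodType) n (P : pred (seq A)) (F : seq A -> V) :
  \sum_(s <- words n.+1 | P s) F s =
  \sum_(a : A) \sum_(s <- words n | P (a :: s)) F (a :: s).
Proof.
rewrite /= big_mkcond big_allpairs_dep /= big_enum /=; apply: eq_bigr => a _.
by rewrite [RHS]big_mkcond.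
Qed.

End Words.
Arguments words : simpl never.
Arguments words_lt : simpl never.

(** * Path weights and powers of the weight matrix *)

Section PathWeight.
Variables (R : realType) (A : finType).
Implicit Types (q p : A -> A -> R[i]) (V : {set A}).

(** Extension by zero keeps all the matrices at size [#|A|]; outside [V] the matrix [I - Q_V] is the
    identity, so its determinant is that of the block on [V]. *)
Definition weight_on V q x y : R[i] := if (x \in V) && (y \in V) then q x y else 0.

Lemma path_weight1 q x : path_weight q [:: x] = 1.
Proof. by rewrite /path_weight big_nil. Qed.

Lemma path_weight_cons q x y s :
  path_weight q [:: x, y & s] = q x y * path_weight q (y :: s).
Proof. by rewrite /path_weight /= big_cons. Qed.

Lemma path_weight_rcons q x s y :
  path_weight q (rcons (x :: s) y) = path_weight q (x :: s) * q (last x s) y.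
Proof.
elim: s x => [|z s IH] x; first by rewrite /= path_weight_cons !path_weight1 mulrC.
by rewrite !rcons_cons !path_weight_cons -rcons_cons IH mulrA.
Qed.

Lemma norm_path_weight q w : `|path_weight q w| = path_weight (fun x y => `|q x y|) w.
Proof. exact: normr_prod. Qed.

(** The start must lie in [V]: a path without steps has weight [1] whatever its vertex is. *)
Lemma path_weight_on V q x s : x \in V ->
  path_weight (weight_on V q) (x :: s) =
  if all (mem V) (x :: s) then path_weight q (x :: s) else 0.
Proof.
elim: s x => [|y s IH] x xV; first by rewrite !path_weight1 /= xV.
rewrite !path_weight_cons {1}/weight_on /= xV /=.
have [yV|yV] := boolP (y \in V); last by rewrite mul0r.
by rewrite IH //= yV /=; case: ifP => _; rewrite ?mulr0.
Qed.

Lemma mx_of_exp q n (i j : 'I_#|A|) : (mx_of q ^+ n) i j =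
  \sum_(s <- words A n | last (enum_val i) s == enum_val j)
     path_weight q (enum_val i :: s).
Proof.
elim: n i => [|n IH] i.
  rewrite big_mkcond big_seq1 /= path_weight1 mxE (inj_eq enum_val_inj).
  by case: (i == j).
rewrite exprS mxE big_wordsS (reindex _ (onW_bij _ (@enum_val_bij A))) /=.
apply: eq_bigr => k _; rewrite IH mxE mulr_sumr.
by apply: eq_bigr => s _; rewrite path_weight_cons.
Qed.

Lemma norm_mx_of_exp q p n (i j : 'I_#|A|) : (forall x y, `|q x y| <= p x y) ->
  `|(mx_of q ^+ n) i j| <= (mx_of p ^+ n) i j.
Proof.
move=> qp; elim: n i j => [|n IH] i j.
  by rewrite !expr0 mxE; case: (i == j); rewrite ?normr0 ?normr1.
rewrite !exprS [X in `|X|]mxE [leRHS]mxE; apply: le_trans (ler_norm_sum _ _ _) _.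
apply: ler_sum => k _; rewrite normrM [mx_of q _ _]mxE [mx_of p _ _]mxE.
by rewrite ler_pM ?normr_ge0.
Qed.

Lemma norm_weight_on V q x y : `|weight_on V q x y| <= `|q x y|.
Proof. by rewrite /weight_on; case: ifP => // _; rewrite normr0. Qed.

Lemma weight_onT q : weight_on [set: A] q = q.
Proof. by apply: funext => x; apply: funext => y; rewrite /weight_on !inE. Qed.

Lemma weight_on_norm V q :
  weight_on V (fun x y => `|q x y|) = fun x y => `|weight_on V q x y|.
Proof.
apply: funext => x; apply: funext => y; rewrite /weight_on.
by case: ifP => //; rewrite normr0.
Qed.

End PathWeight.

(** * Removing a vertex as a cofactor *)

Section Determinants.
Variables (R : realType) (A : finType) (q : A -> A -> R[i]).

(* Row [i] of the left-hand matrix is the [i]-th unit vector. *)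
Lemma det_weight_onD1 (V : {set A}) (i : 'I_#|A|) :
  \det (1%:M - mx_of (weight_on (V :\ enum_val i) q)) =
  cofactor (1%:M - mx_of (weight_on V q)) i i.
Proof.
set B := 1%:M - _; rewrite (expand_det_row B i) (bigD1 i) //= big1 => [|j ji].
  have -> : B i i = 1.
    by rewrite !mxE eqxx /weight_on !inE eqxx /= subr0.
  rewrite addr0 mul1r /cofactor; congr (_ * \det _).
  apply/matrixP => k l; rewrite !mxE /weight_on !inE.
  by rewrite !(inj_eq enum_val_inj) ![_ == i]eq_sym !neq_lift.
by rewrite !mxE eq_sym (negbTE ji) /weight_on !inE eqxx /= subr0 mul0r.
Qed.

Lemma invmx_diag_weight_on (V : {set A}) (i : 'I_#|A|) :
  1%:M - mx_of (weight_on V q) \in unitmx ->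
  invmx (1%:M - mx_of (weight_on V q)) i i =
  \det (1%:M - mx_of (weight_on (V :\ enum_val i) q)) /
  \det (1%:M - mx_of (weight_on V q)).
Proof.
move=> u; rewrite det_weight_onD1 /invmx u !mxE.
by rewrite mulrC.
Qed.

End Determinants.

(** * The Neumann series *)

Section Neumann.
Variable R : realType.

Lemma ccvgS (u : nat -> R[i]) l : ccvg u l -> ccvg (fun n => u n.+1) l.
Proof.
by move=> [ru iu]; split; [move: ru|move: iu]; rewrite -cvg_shiftS.
Qed.

Lemma neumann n (M : 'M[R[i]]_n) :
  (forall i j, abs_summable (fun k => (M ^+ k) i j)) -> 1%:M - M \in unitmx ->
  forall i j, ccvg (fun N => \sum_(k < N) (M ^+ k) i j) (invmx (1%:M - M) i j).
Proof.
move=> sM uM.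
have [L LP] : exists L : 'M[R[i]]_n, forall i j,
    ccvg (fun N => \sum_(k < N) (M ^+ k) i j) (L i j).
  have [f fP] := fin_all_exists (fun ij : 'I_n * 'I_n =>
    abs_summable_ccvg (sM ij.1 ij.2)).
  by exists (\matrix_(i, j) f (i, j)) => i j; rewrite mxE; exact: (fP (i, j)).
suff -> : invmx (1%:M - M) = L by [].
(* [L = 1 + L M] follows by computing the limit of the partial sums with [N.+1] terms in two
   ways. *)
have L1 : L *m (1%:M - M) = 1%:M.
  rewrite mulmxBr mulmx1; apply/eqP; rewrite subr_eq; apply/eqP/matrixP => i j.
  apply: ccvg_unique (ccvgS (LP i j)) _.
  rewrite mxE.
  have -> : (fun N => \sum_(k < N.+1) (M ^+ k) i j) = (fun N =>
      (1%:M : 'M[R[i]]_n) i j + \sum_l M l j * \sum_(k < N) (M ^+ k) i l).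
    apply: funext => N; rewrite big_ord_recl expr0; congr (_ + _).
    under [RHS]eq_bigr do rewrite mulr_sumr.
    rewrite exchange_big; apply: eq_bigr => k _.
    rewrite lift0 exprSr mxE; apply: eq_bigr => l _; exact: mulrC.
  apply: ccvgD; first exact: ccvg_cst.
  rewrite mxE; under [X in ccvg _ X]eq_bigr do rewrite mulrC.
  by apply: ccvg_sum => l; exact: ccvgMl.
by rewrite -[RHS](mulmxK uM) L1 mul1mx.
Qed.

End Neumann.

(** * Consequences of integrability; the Green's function as a Neumann series *)

Section Integrable.
Variables (R : realType) (A : finType).
Implicit Types (q : A -> A -> R[i]) (V : {set A}).

Lemma abs_summable_integrable q : integrable_weight q ->
  forall i j, abs_summable (fun k => (mx_of (fun x y => `|q x y|) ^+ k) i j).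
Proof.
rewrite /integrable_weight => sr; apply: abs_summable_expmx => z ez.
have [rs rsE] := closed_field_poly_normal (char_poly (mx_of (fun x y => `|q x y|))).
rewrite (monicP (char_poly_monic _)) scale1r in rsE.
have Rez : complex.Re `|z| < 1.
  apply: le_lt_trans sr; apply: ub_le_sup; last by exists z.
  (* The supremum dominates its set only if the set is bounded. The eigenvalues are among the
     finitely many roots [rs], so the sum of all moduli is a bound. *)
  exists (\sum_(w <- rs) complex.Re `|w|) => _ [w ew <-].
  have wrs : w \in rs.
    by move: ew; rewrite /= eigenvalue_root_char rsE root_prod_XsubC.
  rewrite (big_rem w) //= lerDl sumr_ge0 // => v _.
  exact: le_trans (normr_ge0 _) (Re_norm_le v).
by rewrite ltcE Rez andbT normc_def /=.
Qed.

Lemma abs_summable_weight_on V q : integrable_weight q ->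
  forall i j, abs_summable (fun k => (mx_of (weight_on V q) ^+ k) i j).
Proof.
move=> iq i j; apply: abs_summable_le (abs_summable_integrable iq i j) => k.
have qle := norm_mx_of_exp k i j (norm_weight_on V q).
apply: (le_trans qle); rewrite ger0_norm //.
exact: le_trans (normr_ge0 _) qle.
Qed.

Lemma integrable_weight_norm q :
  integrable_weight q -> integrable_weight (fun x y => `|q x y|).
Proof.
rewrite /integrable_weight; congr (spectral_radius (mx_of _) < 1).
by apply: funext => x; apply: funext => y; rewrite normr_id.
Qed.

Lemma green_ccvg V q (i j : 'I_#|A|) : integrable_weight q -> enum_val i \in V ->
  ccvg (fun N => \sum_(k < N) (mx_of (weight_on V q) ^+ k) i j)
    (green q V (enum_val i) (enum_val j)).
Proof.
move=> iq iV; set x := enum_val i; set y := enum_val j.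
pose C s := (last x s == y) && all (mem V) (x :: s).
(* A tail of size below [N] is a path of fewer than [N] steps, matching the powers [k < N]. *)
pose E N := [seq x :: s | s <- words_lt A N & C s].
have mem_E N w : reflect (paths_in V x y w /\ (size w <= N)%N) (w \in E N).
  apply: (iffP mapP) => [[s]|[[s [-> lx sV]] sN]].
    rewrite mem_filter mem_words_lt => /andP[/andP[/eqP lx sV] sN] ->.
    by split=> //; exists s; split=> //; exact/allP.
  exists s => //; rewrite mem_filter mem_words_lt sN andbT /C lx eqxx.
  exact/allP.
have sumE p N : \sum_(w <- E N) path_weight p w =
    \sum_(k < N) (mx_of (weight_on V p) ^+ k) i j.
  rewrite big_map big_filter big_words_lt; apply: eq_bigr => k _.
  rewrite mx_of_exp big_mkcondr; apply: eq_bigr => s _.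
  by rewrite path_weight_on.
have -> : (fun N => \sum_(k < N) (mx_of (weight_on V q) ^+ k) i j) =
    (fun N => \sum_(w <- E N) path_weight q w).
  by apply: funext => N; rewrite sumE.
have [c cP] := abs_summable_weight_on V (integrable_weight_norm iq) i j.
apply: (@csum_exhaustion _ _ _ E _ _ _ _ _ c)
  => [N|N w /mem_E[]|N w /mem_E[pw sw]|w pw|N].
- rewrite map_inj_uniq ?filter_uniq ?words_lt_uniq // => s t.
  by case.
- by [].
- by apply/mem_E; split=> //; exact: leqW.
- by exists (size w); apply/mem_E.
under eq_bigr do rewrite norm_path_weight.
rewrite sumE; apply: le_trans (cP N); apply: ler_sum => k _.
by apply: real_ler_norm; apply: ger0_real; rewrite weight_on_norm;
  apply: le_trans (norm_mx_of_exp _ _ _ (fun _ _ => lexx _)).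
Qed.
End Integrable.

(** * Loop masses, determinants and the products of Green's functions *)

Section LoopSums.
Variables (R : realType) (A : finType).
Implicit Types (q : A -> A -> R[i]) (V : {set A}).

(** Reduces independence of the representative picked by [repr] to invariance under a single
    shift. *)
Lemma shift_root_invariant (T : Type) (f : seq A -> T) (l l' : rooted_loop A) :
  (forall w, is_rooted_loop w -> f (shift_root w) = f w) ->
  loop_equiv l l' -> f (val l') = f (val l).
Proof.
move=> fS /asboolP[k <-]; elim: k => [//|k <-]; rewrite iterS; apply: fS.
elim: k => [|k]; first exact: valP.
rewrite iterS; case: (iter k _ _) => [//|x [//|y s]] /= /eqP lx.
by rewrite last_rcons eqxx -size_eq0 size_rcons.
Qed.

Lemma size_shift_root (w : seq A) : is_rooted_loop w -> size (shift_root w) = size w.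
Proof. by case: w => [//|x [//|y s]] _; rewrite /= size_rcons. Qed.

(** The shift drops the root [x], which is still present as the last vertex, and appends [y], which
    was already there. *)
Lemma all_shift_root (P : pred A) (w : seq A) :
  is_rooted_loop w -> all P (shift_root w) = all P w.
Proof.
case: w => [//|x [//|y s]] /= /eqP <-; rewrite all_rcons.
have [h|] := boolP (all P (y :: s)); last by move=> /negbTE /= ->; rewrite !andbF.
by have := h => /= ->; rewrite (allP h) ?mem_head // (allP h) ?mem_last.
Qed.

Lemma path_weight_shift_root q (w : seq A) :
  is_rooted_loop w -> path_weight q (shift_root w) = path_weight q w.
Proof.
case: w => [//|x [//|y s]] /= /eqP lx.
by rewrite -rcons_cons path_weight_rcons lx path_weight_cons mulrC.
Qed.

Lemma loop_equiv_word (r : rooted_loop A) :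
  loop_equiv r (repr (\pi_(unrooted_loop A) r)).
Proof. by apply/eqmodP; rewrite reprK. Qed.

Lemma size_loop_word (r : rooted_loop A) :
  size (loop_word (\pi_(unrooted_loop A) r)) = size (val r).
Proof. exact: (shift_root_invariant size_shift_root (loop_equiv_word r)). Qed.

Lemma all_loop_word P (r : rooted_loop A) :
  all P (loop_word (\pi_(unrooted_loop A) r)) = all P (val r).
Proof. exact: (shift_root_invariant (@all_shift_root P) (loop_equiv_word r)). Qed.

Lemma path_weight_loop_word q (r : rooted_loop A) :
  path_weight q (loop_word (\pi_(unrooted_loop A) r)) = path_weight q (val r).
Proof.
exact: (shift_root_invariant (@path_weight_shift_root q) (loop_equiv_word r)).
Qed.

Definition loops_in V : set (unrooted_loop A) :=
  [set l | all (mem V) (loop_word l)]%classic.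

(* Loops of length at most [N]: words list both end points. *)
Definition rooted_upto V N : seq (rooted_loop A) :=
  pmap insub [seq w <- words_lt A N.+2 | all (mem V) w].

Definition loops_upto V N : seq (unrooted_loop A) :=
  undup [seq \pi_(unrooted_loop A) r | r <- rooted_upto V N].

Lemma mem_rooted_upto V N r :
  (r \in rooted_upto V N) = all (mem V) (val r) && (size (val r) < N.+2)%N.
Proof. by rewrite mem_pmap_sub mem_filter mem_words_lt. Qed.

Lemma rooted_upto_uniq V N : uniq (rooted_upto V N).
Proof. by rewrite pmap_sub_uniq // filter_uniq // words_lt_uniq. Qed.

Lemma mem_loops_upto V N l :
  (l \in loops_upto V N) = all (mem V) (loop_word l) && (size (loop_word l) < N.+2)%N.
Proof.
rewrite mem_undup; apply/mapP/idP => [[r]|h].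
  by rewrite mem_rooted_upto => h ->; rewrite size_loop_word all_loop_word.
by exists (repr l); rewrite ?reprK // mem_rooted_upto.
Qed.

(** All representatives of [l] share its length and its vertices, so the list contains every one of
    them. In particular they form a finite set, without which [fset_set] would be a default
    value. *)
Lemma num_reps_upto V N l : l \in loops_upto V N ->
  num_reps l = count (fun r => \pi_(unrooted_loop A) r == l) (rooted_upto V N).
Proof.
rewrite mem_loops_upto => h; rewrite /num_reps -size_filter.
set s := [seq _ <- _ | _].
have -> : [set r : rooted_loop A | \pi_(unrooted_loop A) r = l]%classic =
    [set` s]%classic.
  apply/seteqP; split=> r /=; rewrite /s mem_filter mem_rooted_upto.
    by move=> rl; rewrite rl eqxx -size_loop_word -all_loop_word rl.
  by case/andP => /eqP.
have us : uniq s by rewrite filter_uniq // rooted_upto_uniq.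
have -> : fset_set [set` s]%classic = [fset r in s]%fset.
  by apply/fsetP => r; rewrite in_fset_set; [rewrite mem_setE !inE|exact: finite_seq].
by rewrite card_fseq undup_id.
Qed.

(* The factor [num_reps] counts the rooted loops in each class. *)
Lemma sum_loop_measure q V N :
  \sum_(l <- loops_upto V N) loop_measure q l =
  \sum_(r <- rooted_upto V N) path_weight q (val r) / (size (val r)).-1%:R.
Proof.
pose g (r : rooted_loop A) := path_weight q (val r) / (size (val r)).-1%:R.
transitivity (\sum_(l <- loops_upto V N)
    \sum_(r <- rooted_upto V N | \pi_(unrooted_loop A) r == l) g r).
  apply: eq_big_seq => l lN; rewrite /loop_measure (num_reps_upto lN).
  rewrite (eq_bigr (fun=> path_weight q (loop_word l) / (loop_length l)%:R)).
    by rewrite big_const_seq iter_addr_0 -mulrA mulr_natl.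
  by move=> r /eqP <-; rewrite /g /loop_length path_weight_loop_word size_loop_word.
rewrite (exchange_big_dep predT) //=; apply: eq_big_seq => r rN.
rewrite big_mkcond (bigD1_seq (\pi_(unrooted_loop A) r)) ?undup_uniq //=; last first.
  by rewrite mem_undup map_f.
by rewrite eqxx big1 ?addr0 // => l lr; rewrite eq_sym (negbTE lr).
Qed.

Lemma sum_loop_measureE q V N :
  \sum_(l <- loops_upto V N) loop_measure q l =
  \sum_(k < N) \tr (mx_of (weight_on V q) ^+ k.+1) / k.+1%:R.
Proof.
rewrite sum_loop_measure.
rewrite -(big_map val predT (fun w => path_weight q w / (size w).-1%:R)) /=.
rewrite /rooted_upto (pmap_filter (insubK _)) big_filter /= big_filter_cond.
under eq_bigl do rewrite isSome_insub.
(* Words of size 0 and 1 are not loops, so these two terms vanish; a loop of length [k.+1] is a root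
   followed by a word of size [k.+1]. *)
rewrite big_words_lt !big_ord_recl /= big_mkcond big_seq1 /= add0r.
rewrite big1_seq ?add0r => [|w]; last first.
  by rewrite mem_words => /andP[/andP[_]]; case: w => [//|x [|y s]] //=.
apply: eq_bigr => k _; rewrite /bump /= !add1n big_wordsS /mxtrace mulr_suml.
rewrite (reindex _ (onW_bij _ (@enum_val_bij A))) /=; apply: eq_bigr => i _.
rewrite mx_of_exp mulr_suml big_mkcond [RHS]big_mkcond; apply: eq_big_seq => s.
rewrite mem_words => /eqP sk; have -> : s != [::] by rewrite -size_eq0 sk.
rewrite sk /=; case: ifP => [/andP[/andP[iV sV] ->]|].
  by rewrite path_weight_on //= iV sV.
case: (_ == _) => //; rewrite andbT => /negbT nV.
have [iV|iV] := boolP (enum_val i \in V).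
  by rewrite path_weight_on //= (negbTE nV) mul0r.
(* With the root outside [V], [path_weight_on] does not apply; the loop has at least one step, and
   its first step has weight zero. *)
case: s sk {nV} => [//|y s] _.
by rewrite path_weight_cons /weight_on (negbTE iV) /= !mul0r.
Qed.

Lemma norm_loop_measure q l :
  `|loop_measure q l| = loop_measure (fun x y => `|q x y|) l.
Proof. by rewrite /loop_measure !normrM normfV !normr_nat norm_path_weight. Qed.

Lemma abs_summable_trace q V : integrable_weight q ->
  abs_summable (fun k => \tr (mx_of (weight_on V q) ^+ k.+1) / k.+1%:R).
Proof.
move=> iq; pose u k := \tr (mx_of (weight_on V q) ^+ k).
apply: (@abs_summable_le _ _ (fun k => u k.+1)) => [k|].
  by rewrite normrM normfV normr_nat ler_piMr // invf_le1 ?ltr0n // ler1n.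
have [c uc] : abs_summable u.
  by apply: abs_summable_sum => i; exact: abs_summable_weight_on.
exists c => N; apply: le_trans (uc N.+1).
rewrite big_ord_recl; by apply: ler_wpDl.
Qed.

(** The modulus of the loop measure of [q] is the loop measure of [|q|], so the trace formula also
    evaluates the absolute sums. *)
Lemma loop_measure_bounded q V : integrable_weight q ->
  exists c : R[i], forall N, \sum_(l <- loops_upto V N) `|loop_measure q l| <= c.
Proof.
move=> iq; have [c cP] := abs_summable_trace V (integrable_weight_norm iq).
exists c => N; under eq_bigr do rewrite norm_loop_measure.
rewrite sum_loop_measureE; apply: le_trans (cP N).
apply: le_trans (ler_norm_sum _ _ _); rewrite ger0_norm //.
rewrite -sum_loop_measureE; apply: sumr_ge0 => l _.
by rewrite -norm_loop_measure.
Qed.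

Lemma loops_upto_incr V N : {subset loops_upto V N <= loops_upto V N.+1}.
Proof. by move=> l; rewrite !mem_loops_upto => /andP[-> /leqW]. Qed.

Lemma loop_mass_ccvg q V : integrable_weight q ->
  ccvg (fun N => \sum_(k < N) \tr (mx_of (weight_on V q) ^+ k.+1) / k.+1%:R)
    (loop_mass q (loops_in V)).
Proof.
move=> iq; have [c cP] := loop_measure_bounded V iq.
under eq_fun do rewrite -sum_loop_measureE.
apply: (@csum_exhaustion _ _ _ (loops_upto V) _ _ _ _ _ c) => //.
- by move=> N; exact: undup_uniq.
- by move=> N l; rewrite mem_loops_upto => /andP[].
- by move=> N; exact: loops_upto_incr.
- move=> l lV; exists (size (loop_word l)); rewrite mem_loops_upto.
  by rewrite [all _ _]lV ltnW.
Qed.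

(** The splitting into loops that meet [B] and loops that avoid it is made on the finite lists and
    then passed to the limit, so no additivity of [csum] is required. *)
Lemma loop_mass_through q (B : {set A}) : integrable_weight q ->
  loop_mass q (loops_through B) =
  loop_mass q (loops_in [set: A]%SET) - loop_mass q (loops_in (~: B)).
Proof.
move=> iq; have [c cP] := loop_measure_bounded [set: A]%SET iq.
pose out l := ~~ all (mem (~: B)) (loop_word l).
pose E N := [seq l <- loops_upto [set: A]%SET N | out l].
have outP l : reflect (loops_through B l) (out l).
  apply: (iffP allPn) => [[x xl]|[x xB xl]].
    by rewrite /= !inE negbK => xB; exists x.
  by exists x; rewrite //= !inE xB.
have mem_E N l : (l \in E N) = out l && (l \in loops_upto [set: A]%SET N).
  by rewrite mem_filter.
have inT l : all (mem [set: A]%SET) (loop_word l).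
  by apply/allP => x _; rewrite /= inE.
have EP : ccvg (fun N => \sum_(l <- E N) loop_measure q l)
    (loop_mass q (loops_through B)).
  apply: (@csum_exhaustion _ _ _ E _ _ _ _ _ c).
  - by move=> N; rewrite filter_uniq // undup_uniq.
  - by move=> N l; rewrite mem_E => /andP[/outP].
  - by move=> N l; rewrite !mem_E => /andP[-> /loops_upto_incr].
  - move=> l /outP lB; exists (size (loop_word l)).
    by rewrite mem_E lB mem_loops_upto inT ltnW.
  move=> N; apply: le_trans (cP N); rewrite big_filter.
  by rewrite [leRHS](bigID out) /= lerDl sumr_ge0.
apply/eqP; rewrite eq_sym subr_eq; apply/eqP.
apply: ccvg_unique (loop_mass_ccvg _ iq) _.
rewrite [X in ccvg X](_ : _ = (fun N => \sum_(l <- E N) loop_measure q l +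
    \sum_(k < N) \tr (mx_of (weight_on (~: B) q) ^+ k.+1) / k.+1%:R)).
  exact: ccvgD EP (loop_mass_ccvg _ iq).
apply: funext => N.
rewrite -[LHS]sum_loop_measureE -[X in _ + X]sum_loop_measureE big_filter.
rewrite [LHS](bigID out) /=; congr (_ + _); rewrite -big_filter.
apply: perm_big; apply: uniq_perm; rewrite ?filter_uniq ?undup_uniq //.
by move=> l; rewrite mem_filter !mem_loops_upto inT /out negbK.
Qed.

(** The determinant is a product of factors [1 - r] with [|r| < 1]. Its nonvanishing is recorded
    along with the formula because the inversions and cancellations below depend on it. *)
Lemma exp_loop_mass q V : integrable_weight q ->
  \det (1%:M - mx_of (weight_on V q)) != 0 /\
  cexp (loop_mass q (loops_in V)) = (\det (1%:M - mx_of (weight_on V q)))^-1.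
Proof.
move=> iq; have sM := abs_summable_weight_on V iq.
have [rs [eig -> trE]] := trace_det_eigen (mx_of (weight_on V q)).
have rs1 i : `|rs i| < 1 by apply: eigenvalue_abs_summable (eig i).
split.
  apply/prodf_neq0 => i _; rewrite subr_eq0 eq_sym.
  by apply: contraTneq (rs1 i) => ->; rewrite normr1 ltxx.
have /fin_all_exists[L LP] i : exists l,
    ccvg (fun N => \sum_(k < N) rs i ^+ k.+1 / k.+1%:R) l /\
    cexp l = (1 - rs i)^-1.
  by have [l l1 l2] := cexp_log_series (rs1 i); exists l.
have -> : loop_mass q (loops_in V) = \sum_i L i.
  apply: ccvg_unique (loop_mass_ccvg V iq) _.
  under eq_fun => N.
    under eq_bigr do rewrite trE mulr_suml.
    rewrite exchange_big; over.
  by apply: ccvg_sum => i; exact: (LP i).1.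
rewrite cexp_sum -prodfV; apply: eq_bigr => i _; exact: (LP i).2.
Qed.

Lemma green_diag q V x : integrable_weight q -> x \in V ->
  green q V x x = \det (1%:M - mx_of (weight_on (V :\ x) q)) /
                  \det (1%:M - mx_of (weight_on V q)).
Proof.
move=> iq xV; rewrite -(enum_rankK x) in xV *; set i := enum_rank x in xV *.
have u : 1%:M - mx_of (weight_on V q) \in unitmx.
  by rewrite unitmxE unitfE; case: (exp_loop_mass V iq).
rewrite -invmx_diag_weight_on //.
apply: ccvg_unique (green_ccvg i iq xV) _.
by apply: neumann => //; exact: abs_summable_weight_on.
Qed.

(** Stated for every [V] because the recursion shrinks [V]. Distinctness keeps each vertex inside
    the current set, where [green_diag] applies. *)
Lemma Fprod_fromE q V xs : integrable_weight q -> uniq xs -> {subset xs <= V} ->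
  Fprod_from q V xs = \det (1%:M - mx_of (weight_on (V :\: [set x in xs]) q)) /
                      \det (1%:M - mx_of (weight_on V q)).
Proof.
move=> iq; elim: xs V => [|x xs IH] V /=.
  move=> _ _; rewrite [X in V :\: X](_ : _ = finset.set0) ?finset.setD0 ?divff //.
  by case: (exp_loop_mass V iq).
case/andP => xxs uxs sV.
rewrite green_diag // ?IH //; last 2 first.
- move=> y yxs; rewrite !inE sV ?in_cons ?yxs ?orbT // andbT.
  by apply: contraNneq xxs => <-.
- by apply: sV; rewrite mem_head.
(* The telescoping: the determinant of [V :\ x] is the numerator of the Green factor and the
   denominator given by induction. *)
rewrite mulrC mulrA divfK; last by case: (exp_loop_mass (V :\ x) iq).
congr (\det (_ - mx_of (weight_on _ q)) / _); apply/finset.setP => y; rewrite !inE.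
by case: (y == x); case: (y \in xs).
Qed.

End LoopSums.

Theorem proposition5p2 (R : realType) (A : finType) (q : A -> A -> R[i])
    (hq : integrable_weight q) :
  [/\ (forall x : A,
         cexp (loop_mass q (loops_through [set x]%SET)) = green q [set: A]%SET x x),
      (* xs ranges over all the orderings of B *)
      (forall (B : {set A}) (xs : seq A), perm_eq xs (enum B) ->
         Fprod q xs = cexp (loop_mass q (loops_through B))) &
      (forall xs : seq A, perm_eq xs (enum A) ->
         [/\ cexp (loop_mass q [set: unrooted_loop A]%classic) = Fprod q xs,
             Fprod q xs = \det (mx_of (green q [set: A]%SET)) &
             \det (mx_of (green q [set: A]%SET)) =
               1 / \det (1%:M - mx_of q)])].
Proof.
have expE B : cexp (loop_mass q (loops_through B)) =
    \det (1%:M - mx_of (weight_on (~: B) q)) /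
    \det (1%:M - mx_of (weight_on [set: A]%SET q)).
  have [_ eT] := exp_loop_mass [set: A]%SET hq.
  have [_ eB] := exp_loop_mass (~: B) hq.
  by rewrite loop_mass_through // cexpD cexpN eT eB invrK mulrC.
have FE (B : {set A}) xs : perm_eq xs (enum B) ->
    Fprod q xs = cexp (loop_mass q (loops_through B)).
  move=> xsB; have uxs : uniq xs by rewrite (perm_uniq xsB) enum_uniq.
  rewrite expE /Fprod Fprod_fromE // => [|x]; last by rewrite inE.
  congr (\det (_ - mx_of (weight_on _ q)) / _); rewrite finset.setTD; congr (~: _).
  by apply/finset.setP => x; rewrite inE (perm_mem xsB) mem_enum.
have detG : \det (mx_of (green q [set: A]%SET)) = 1 / \det (1%:M - mx_of q).
  have [dT _] := exp_loop_mass [set: A]%SET hq; rewrite weight_onT in dT.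
  have u : 1%:M - mx_of q \in unitmx by rewrite unitmxE unitfE.
  (* All entries of the Green matrix, off the diagonal too, are limits of the Neumann series, so the
     matrix is the inverse of [1 - Q]. *)
  rewrite div1r -det_inv; congr (\det _); apply/matrixP => i j; rewrite mxE.
  apply: ccvg_unique (green_ccvg j hq (finset.in_setT _)) _; rewrite weight_onT.
  apply: neumann => // k l.
  by have := abs_summable_weight_on [set: A]%SET hq k l; rewrite weight_onT.
split=> // [x|xs xsA].
  by rewrite expE (green_diag hq (finset.in_setT x)) finset.setTD.
have xsT : perm_eq xs (enum [set: A]%SET) by rewrite enum_setT -enumT.
(* For [B = A] the complement is empty, its matrix is zero, and the numerator in [expE] becomes
   1. *)
have d0 : \det (1%:M - mx_of (weight_on (finset.set0 : {set A}) q)) = 1.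
  have -> : mx_of (weight_on (finset.set0 : {set A}) q) = 0.
    by apply/matrixP => i j; rewrite !mxE /weight_on inE.
  by rewrite subr0 det1.
have FG : Fprod q xs = \det (mx_of (green q [set: A]%SET)).
  by rewrite (FE _ _ xsT) expE detG finset.setCT d0 weight_onT.
split=> //; rewrite FG detG.
have -> : [set: unrooted_loop A]%classic = loops_in [set: A]%SET.
  apply/seteqP; split=> // l _; apply/allP => x _; exact: finset.in_setT.
by have [_ ->] := exp_loop_mass [set: A]%SET hq; rewrite weight_onT div1r.
Qed.
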